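(* Let $H$ be the complex Hilbert space of dimension $n$, and let $m<4n-4$. Assume the following statement (O) holds true for this $m$: (O) For any frame $\mathcal{F}=\{f_1,\ldots,f_m\}\subset H$ for $H$ that is not a phase retrievable frame for $H$, there exists a $\rho>0$ such that any other set $\mathcal{F}'=\{f_1',\ldots,f_m'\}\subset H$ with $\|f_k-f_k'\|<\rho$ for all $1\leq k\leq m$ is also not phase retrievable. Then no set $\mathcal{G}=\{g_1,\ldots,g_m\}\subset H$ of $m$ vectors in $H$ is a phase retrievable frame for $H$.
   Context: $H$ is the complex Hilbert space $\mathbb{C}^n$ with the usual scalar product $\langle x,y\rangle=\sum_{k=1}^n x_k\overline{y_k}$ and the associated norm. Finite sets of vectors $\{f_1,\ldots,f_m\}$ are indexed families (repetitions allowed). Such a family is a frame for $H$ if there are constants $0<A\leq B<\infty$ with $A\|x\|^2\leq\sum_{k=1}^m|\langle x,f_k\rangle|^2\leq B\|x\|^2$ for all $x\in H$; in finite dimension this is equivalent to $\mathrm{span}\{f_1,\ldots,f_m\}=H$. On $H$ define $x\sim y$ if and only if there is $z\in\mathbb{C}$ with $|z|=1$ and $y=zx$; let $\hat{H}=H/\sim$ and let $\hat{x}$ denote the class of $x$. A frame $\{f_1,\ldots,f_m\}$ for $H$ is called phase retrievable if the (well-defined) map $\alpha:\hat{H}\to\mathbb{R}^m$, $(\alpha(\hat{x}))_k=|\langle x,f_k\rangle|$, $1\leq k\leq m$, is injective. A family is ''not phase retrievable'' if it is not a phase retrievable frame for $H$. *)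

(* Defs.v *)
From HB Require Import structures.
From mathcomp Require Import all_boot all_order all_algebra.
From mathcomp Require Import boolp reals.
From mathcomp Require Import complex.

Set Implicit Arguments.
Unset Strict Implicit.
Unset Printing Implicit Defensive.

Import Order.TTheory GRing.Theory Num.Theory.
Export ComplexField.Normc.

Local Open Scope ring_scope.
Local Open Scope complex_scope.
Local Open Scope quotient_scope.

(** [normc z : R] is the modulus of [z : R[i]] as a real number, and
    [dotmx x y] is the Hermitian product on row vectors, linear in [x]. *)

Lemma dotmx_sum (R : realType) (n : nat) (x y : 'rV[R[i]]_n) :
  dotmx x y = \sum_k x 0 k * (y 0 k)^*%C.
Proof.
by rewrite dotmxE mxE; apply: eq_bigr => k _; rewrite !mxE.
Qed.

(** The norm of the Hilbert space; the generic [`|x|] on matrices would be a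
    sup norm. *)
Definition hilbert_norm (R : realType) (n : nat) (x : 'rV[R[i]]_n) : R :=
  Num.sqrt (complex.Re (dotmx x x)).

Lemma hilbert_norm_sum (R : realType) (n : nat) (x : 'rV[R[i]]_n) :
  hilbert_norm x = Num.sqrt (\sum_k normc (x 0 k) ^+ 2).
Proof.
rewrite /hilbert_norm dotmx_sum raddf_sum; congr Num.sqrt.
apply: eq_bigr => k _; case: (x 0 k) => a b /=.
by rewrite sqr_sqrtr ?addr_ge0 ?sqr_ge0// mulrN opprK !expr2.
Qed.

Definition is_frame (R : realType) (n m : nat)
    (f : 'I_m -> 'rV[R[i]]_n) : Prop :=
  exists A B : R, [/\ 0 < A, A <= B &
    forall x : 'rV[R[i]]_n,
      A * hilbert_norm x ^+ 2 <= \sum_k normc (dotmx x (f k)) ^+ 2 /\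
      \sum_k normc (dotmx x (f k)) ^+ 2 <= B * hilbert_norm x ^+ 2].

Definition phase_eq (R : realType) (n : nat) : rel 'rV[R[i]]_n :=
  fun x y => `[< exists z : R[i], normc z = 1 /\ y = z *: x >].

Lemma phase_eq_refl (R : realType) (n : nat) : reflexive (@phase_eq R n).
Proof. by move=> x; apply/asboolP; exists 1; rewrite normc1 scale1r. Qed.

Lemma phase_eq_sym (R : realType) (n : nat) : symmetric (@phase_eq R n).
Proof.
have H x y : phase_eq x y -> @phase_eq R n y x.
  move=> /asboolP[z [z1 ->]]; apply/asboolP; exists z^-1.
  have z0 : z != 0.
    by apply/eqP => z0; move: z1; rewrite z0 normc0 => /eqP; rewrite eq_sym oner_eq0.
  by rewrite normcV z1 invr1 scalerA mulVf// scale1r.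
by move=> x y; apply/idP/idP; exact: H.
Qed.

Lemma phase_eq_trans (R : realType) (n : nat) : transitive (@phase_eq R n).
Proof.
move=> y x w /asboolP[z [z1 ->]] /asboolP[z' [z'1 ->]]; apply/asboolP.
by exists (z' * z); rewrite normcM z1 z'1 mulr1 scalerA.
Qed.

Canonical phase_eq_equiv (R : realType) (n : nat) :=
  EquivRel (@phase_eq R n) (@phase_eq_refl R n) (@phase_eq_sym R n)
    (@phase_eq_trans R n).

(** The quotient of the Hilbert space by unimodular scalars. *)
Definition Hhat (R : realType) (n : nat) := {eq_quot (@phase_eq R n)}.

Definition alpha (R : realType) (n m : nat) (f : 'I_m -> 'rV[R[i]]_n)
    (xhat : Hhat R n) : 'rV[R]_m :=
  \row_k normc (dotmx (repr xhat) (f k)).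

(** The value of [alpha] does not depend on the representative. *)
Lemma alphaE (R : realType) (n m : nat) (f : 'I_m -> 'rV[R[i]]_n)
    (x : 'rV[R[i]]_n) (k : 'I_m) :
  alpha f (\pi_(Hhat R n) x) 0 k = normc (dotmx x (f k)).
Proof.
rewrite /alpha mxE.
have /eqmodP/asboolP[z [z1 ->]] :
    x = repr (\pi_(Hhat R n) x) %[mod Hhat R n] by rewrite reprK.
by rewrite linearZl_LR normcM z1 mul1r.
Qed.

Definition phase_retrievable (R : realType) (n m : nat)
    (f : 'I_m -> 'rV[R[i]]_n) : Prop :=
  is_frame f /\ injective (@alpha R n m f).

(* Main.v *)
Require Import Defs.
From mathcomp Require Import all_boot all_order all_algebra.
From mathcomp Require Import boolp reals complex.

Set Implicit Arguments.
Unset Strict Implicit.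
Unset Printing Implicit Defensive.

Import Order.TTheory GRing.Theory Num.Theory.

Local Open Scope ring_scope.
Local Open Scope complex_scope.

(** If [g] is phase retrievable, it spans the space, so some [n] of its
    vectors, indexed by a set [S], form a basis.  Let [f] agree with [g] on
    [S] and vanish off [S].  It is a frame, but a basis padded by zeros only
    records the moduli of [n] independent coordinates, and so for [n >= 2] it
    does not retrieve phases ([basis_not_phase_retrievable]).  For [a > 0] let
    [f'] agree with [g] on [S] and equal [a *: g] off [S].  Rescaling a vector
    by [a != 0] rescales the corresponding measurement by a known nonzero
    factor, so [f'] is still phase retrievable ([damp_phase_retrievable]).
    As [a] tends to [0] the families [f'] converge to [f]: the non
    phase retrievable frame [f] is a limit of phase retrievable frames, which
    is what openness (O) forbids.  The bound [m < 4 * n - 4] forces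
    [2 <= n]. *)

(** * The Hilbert norm *)

Section Norm.
Variables (R : realType) (n : nat).
Implicit Types u v : 'rV[R[i]]_n.

Lemma normc_ge0 (z : R[i]) : 0 <= normc z.
Proof. by case: z => x y; exact: sqrtr_ge0. Qed.

Lemma normc_sum (I : finType) (F : I -> R[i]) :
  normc (\sum_i F i) <= \sum_i normc (F i).
Proof.
elim/big_ind2: _ => [|x1 x2 y1 y2 h1 h2|//]; first by rewrite normc0.
exact: le_trans (le_normcD _ _) (lerD h1 h2).
Qed.

Lemma hilbert_norm_ge0 u : 0 <= hilbert_norm u.
Proof. exact: sqrtr_ge0. Qed.

Lemma hilbert_norm_sqr u : hilbert_norm u ^+ 2 = \sum_k normc (u 0 k) ^+ 2.
Proof.
by rewrite hilbert_norm_sum sqr_sqrtr// sumr_ge0// => k _; rewrite sqr_ge0.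
Qed.

Lemma hilbert_norm0 : hilbert_norm (0 : 'rV[R[i]]_n) = 0.
Proof.
rewrite hilbert_norm_sum big1 ?sqrtr0// => k _.
by rewrite mxE normc0 expr0n.
Qed.

Lemma hilbert_norm_eq0 u : hilbert_norm u = 0 -> u = 0.
Proof.
move=> u0; have /psumr_eq0P h : \sum_k normc (u 0 k) ^+ 2 = 0.
  by rewrite -hilbert_norm_sqr u0 expr0n.
apply/rowP => k; rewrite mxE; apply: eq0_normc; apply/eqP.
by rewrite -sqrf_eq0 h// => i _; rewrite sqr_ge0.
Qed.

Lemma hilbert_normZ (a : R[i]) u :
  hilbert_norm (a *: u) = normc a * hilbert_norm u.
Proof.
apply/eqP; rewrite -(@eqrXn2 _ 2)// ?mulr_ge0 ?hilbert_norm_ge0 ?normc_ge0//.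
rewrite (hilbert_norm_sqr (a *: u)) [X in _ == X]exprMn (hilbert_norm_sqr u).
rewrite mulr_sumr; apply/eqP/eq_bigr => k _.
by rewrite mxE normcM exprMn.
Qed.

Lemma normc_le_hilbert_norm u k : normc (u 0 k) <= hilbert_norm u.
Proof.
rewrite -(@ler_pXn2r _ 2) ?nnegrE ?hilbert_norm_ge0 ?normc_ge0//.
rewrite hilbert_norm_sqr (bigD1 k)//= lerDl.
by apply: sumr_ge0 => j _; rewrite sqr_ge0.
Qed.

End Norm.

(** Both frame constants come from this bound: the upper one from the analysis
    matrix itself, the lower one from a right inverse of it. *)
Lemma mulmx_bounded (R : realType) (n p : nat) (P : 'M[R[i]]_(n, p)) :
  exists2 C : R, 0 < C &
    forall u, hilbert_norm (u *m P) ^+ 2 <= C * hilbert_norm u ^+ 2.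
Proof.
pose c k := \sum_j normc (P j k).
have c0 k : 0 <= c k by apply: sumr_ge0 => j _; exact: normc_ge0.
have C0 : 0 <= \sum_k c k ^+ 2 by apply: sumr_ge0 => k _; rewrite sqr_ge0.
exists (1 + \sum_k c k ^+ 2) => [|u]; first by rewrite ltr_wpDr.
apply: (@le_trans _ _ ((\sum_k c k ^+ 2) * hilbert_norm u ^+ 2)); last first.
  by rewrite ler_wpM2r ?sqr_ge0// lerDr.
rewrite hilbert_norm_sqr mulr_suml; apply: ler_sum => k _.
rewrite -exprMn ler_pXn2r ?nnegrE ?mulr_ge0 ?hilbert_norm_ge0 ?normc_ge0//.
rewrite mxE; apply: le_trans (normc_sum _) _.
rewrite mulr_suml; apply: ler_sum => j _.
by rewrite normcM mulrC ler_wpM2l ?normc_ge0 ?normc_le_hilbert_norm.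
Qed.

(** * Frames and their analysis matrix *)

Section Frame.
Variables (R : realType) (n : nat).

(** The matrix of [x |-> (<x, f_k>)_k], acting on row vectors; whence the
    conjugates. *)
Definition analysis_mx m (f : 'I_m -> 'rV[R[i]]_n) : 'M[R[i]]_(n, m) :=
  \matrix_(j, k) ((f k) 0 j)^*.

Lemma mulmx_analysis m (f : 'I_m -> 'rV[R[i]]_n) x k :
  (x *m analysis_mx f) 0 k = dotmx x (f k).
Proof. by rewrite dotmx_sum mxE; apply: eq_bigr => j _; rewrite mxE. Qed.

(** An injective analysis map has a right inverse matrix, and the boundedness of
    the latter is the lower frame inequality. *)
Lemma is_frameP m (f : 'I_m -> 'rV[R[i]]_n) :
  is_frame f <-> row_free (analysis_mx f).
Proof.
have energy x : \sum_k normc (dotmx x (f k)) ^+ 2 =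
    hilbert_norm (x *m analysis_mx f) ^+ 2.
  by rewrite hilbert_norm_sqr; apply: eq_bigr => k _; rewrite mulmx_analysis.
split=> [[A [B [A0 _ AB]]]|/row_freeP[Q fQ]].
  apply: inj_row_free => x x0; apply: hilbert_norm_eq0; apply/eqP.
  have [+ _] := AB x; rewrite energy x0 hilbert_norm0 expr0n /=.
  by rewrite pmulr_rle0// -sqrf_eq0 eq_le sqr_ge0 andbT.
have [C C0 hC] := mulmx_bounded Q.
have [B B0 hB] := mulmx_bounded (analysis_mx f).
exists C^-1, (Num.max C^-1 B); split=> [||x]; rewrite ?invr_gt0// ?le_max ?lexx//.
rewrite energy; split.
  rewrite ler_pdivrMl//; apply: le_trans (hC _).
  by rewrite -mulmxA fQ mulmx1.
by apply: le_trans (hB x) _; rewrite ler_wpM2r ?sqr_ge0// le_max lexx orbT.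
Qed.

Lemma alpha_injP m (f : 'I_m -> 'rV[R[i]]_n) :
  injective (@alpha R n m f) <->
  forall x y, (forall k, normc (dotmx x (f k)) = normc (dotmx y (f k))) ->
    phase_eq x y.
Proof.
split=> [inj x y xy|inj xh yh].
  apply/eqmodP/inj/rowP => k.
  exact: etrans (alphaE f x k) (etrans (xy k) (esym (alphaE f y k))).
rewrite -[xh]reprK -[yh]reprK => /rowP h; apply/eqmodP/inj => k.
exact: etrans (esym (alphaE f _ k)) (etrans (h k) (alphaE f _ k)).
Qed.

Lemma is_frame_sub m p (s : 'I_p -> 'I_m) (f : 'I_m -> 'rV[R[i]]_n) :
  is_frame (f \o s) -> is_frame f.
Proof.
move=> /is_frameP fr; apply/is_frameP/inj_row_free => x /rowP x0.
apply: (row_free_inj fr); rewrite mul0mx; apply/rowP => j.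
by have := x0 (s j); rewrite !mulmx_analysis !mxE.
Qed.

(** A spanning family contains a basis; the basis property is expressed by
    an invertible analysis matrix because that is what produces a vector with
    prescribed measurements. *)
Lemma frame_basis m (f : 'I_m -> 'rV[R[i]]_n) : is_frame f ->
  exists s : 'I_n -> 'I_m, analysis_mx (f \o s) \in unitmx.
Proof.
move=> /is_frameP fr.
have full : row_full (analysis_mx f)^T by rewrite /row_full mxrank_tr.
exists (fullrankfun full); rewrite -unitmx_tr.
have := fullrowsub_unit full; congr (_ \in unitmx).
by apply/matrixP => j k; rewrite !mxE.
Qed.

End Frame.

(** * Damping a frame off a basis *)

Section Damp.
Variables (R : realType) (n m : nat).
Implicit Type f : 'I_m -> 'rV[R[i]]_n.

Definition damp (S : {set 'I_m}) (a : R[i]) f : 'I_m -> 'rV[R[i]]_n :=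
  fun k => if k \in S then f k else a *: f k.

Lemma dotmxZr (a : R[i]) (x y : 'rV[R[i]]_n) :
  dotmx x (a *: y) = a^* * dotmx x y.
Proof.
rewrite !dotmx_sum mulr_sumr; apply: eq_bigr => k _.
by rewrite mxE rmorphM /= mulrCA.
Qed.

Lemma hilbert_norm_damp S a f k :
  hilbert_norm (damp S 0 f k - damp S a f k) <= normc a * hilbert_norm (f k).
Proof.
rewrite /damp; case: ifP => _.
  by rewrite subrr hilbert_norm0 mulr_ge0 ?normc_ge0 ?hilbert_norm_ge0.
by rewrite scale0r sub0r -scaleNr hilbert_normZ normcN.
Qed.

(** The modulus [normc a] divides out of the damped measurements, so those of
    [f] are recovered. *)
Lemma damp_phase_retrievable S a f :
  a != 0 -> phase_retrievable f -> phase_retrievable (damp S a f).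
Proof.
move=> a0 [/is_frameP fr /alpha_injP inj].
have ac0 : a^* != 0 by rewrite fmorph_eq0.
have cancel_ac (z w : R[i]) :
    normc (a^* * z) = normc (a^* * w) -> normc z = normc w.
  rewrite !normcM => /mulfI; apply.
  by apply: contra ac0 => /eqP/eq0_normc/eqP.
split.
  apply/is_frameP/inj_row_free => x /rowP x0.
  apply: (row_free_inj fr); rewrite mul0mx; apply/rowP => k.
  have := x0 k; rewrite !mulmx_analysis !mxE /damp.
  case: ifP => _; first exact: id.
  rewrite dotmxZr => /eqP.
  by rewrite mulf_eq0 (negPf ac0) => /eqP.
apply/alpha_injP => x y xy; apply: inj => k.
have := xy k; rewrite /damp; case: ifP => _; first exact: id.
by rewrite (dotmxZr a x) (dotmxZr a y) => /cancel_ac.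
Qed.

(** A basis has vectors with measurements [(1, 1, 0, ..)] and
    [(1, -1, 0, ..)].  These measurements have the same moduli, but a phase
    relating the two vectors would have to be both [1] and [-1]. *)
Lemma basis_not_phase_retrievable (s : 'I_n -> 'I_m) f :
  (1 < n)%N ->
  analysis_mx (f \o s) \in unitmx ->
  (forall k, k \notin codom s -> f k = 0) ->
  ~ phase_retrievable f.
Proof.
move=> n1 su f0 [_ /alpha_injP inj].
have interp (c : 'rV[R[i]]_n) : exists x, forall j, dotmx x (f (s j)) = c 0 j.
  exists (c *m invmx (analysis_mx (f \o s))) => j.
  by rewrite -[in RHS](mulmxKV su c) mulmx_analysis.
pose i0 : 'I_n := Ordinal (ltnW n1); pose i1 : 'I_n := Ordinal n1.
have i10 : (i1 == i0) = false by [].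
have [x hx] := interp (delta_mx 0 i0 + delta_mx 0 i1).
have [y hy] := interp (delta_mx 0 i0 - delta_mx 0 i1).
have /asboolP[z [_ yz]] : phase_eq x y.
  apply: inj => k; have [/codomP[j ->]|/f0 ->] := boolP (k \in codom s).
    rewrite hx hy !mxE !eqxx /=.
    have [->|_] := eqVneq j i0; first by rewrite eq_sym i10 subr0 addr0.
    by rewrite add0r sub0r normcN.
  by rewrite !linear0r.
have := hy i1; have := hy i0.
rewrite yz !linearZl_LR /= !hx !mxE !eqxx i10 eq_sym i10 /=.
rewrite addr0 add0r subr0 sub0r mulr1 => -> /eqP.
by rewrite eq_sym eqNr oner_eq0.
Qed.

End Damp.

Lemma small_scaling (R : realFieldType) (I : finType) (F : I -> R) (rho : R) :
  0 < rho -> (forall k, 0 <= F k) ->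
  exists2 a, 0 < a & forall k, a * F k < rho.
Proof.
move=> rho0 F0; have M0 : 0 < 1 + \sum_k F k by rewrite ltr_wpDr ?sumr_ge0.
exists (rho / (1 + \sum_k F k)) => [|k]; first by rewrite divr_gt0.
rewrite mulrAC ltr_pdivrMr// ltr_pM2l// (bigD1 k)//= addrCA ltrDl.
by rewrite ltr_wpDr ?sumr_ge0.
Qed.

Theorem proposition5p1 (R : realType) (n m : nat)
  (hm : (m < 4 * n - 4)%N)
  (hO : forall f : 'I_m -> 'rV[R[i]]_n,
    is_frame f -> ~ phase_retrievable f ->
    exists rho : R, 0 < rho /\
      forall f' : 'I_m -> 'rV[R[i]]_n,
        (forall k : 'I_m, hilbert_norm (f k - f' k) < rho) ->
        ~ phase_retrievable f') :
  forall g : 'I_m -> 'rV[R[i]]_n, ~ phase_retrievable g.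
Proof.
move=> g gPR; have [gfr _] := gPR.
have n1 : (1 < n)%N by case: n hm {hO g gPR gfr} => [|[]].
have [s hs] := frame_basis gfr.
pose S := [set k | k \in codom s].
(* On [S] nothing has changed, so [damp S 0 g] still contains the basis. *)
have onS : analysis_mx (damp S 0 g \o s) \in unitmx.
  suff -> : damp S 0 g \o s = g \o s by [].
  by apply: funext => j; rewrite /= /damp inE codom_f.
have ffr : is_frame (damp S 0 g).
  by apply: (is_frame_sub (s := s)); apply/is_frameP; rewrite row_free_unit.
have fNPR : ~ phase_retrievable (damp S 0 g).
  apply: basis_not_phase_retrievable n1 onS _ => k ks.
  by rewrite /damp inE (negPf ks) scale0r.
have [rho [rho0 hrho]] := hO _ ffr fNPR.
have [a a0 a_small] := small_scaling rho0 (fun k => hilbert_norm_ge0 (g k)).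
have na : normc a%:C = a by rewrite /= expr0n addr0 sqrtr_sqr gtr0_norm.
apply: (hrho (damp S a%:C g)) => [k|].
  by apply: le_lt_trans (hilbert_norm_damp _ _ _ _) _; rewrite na; exact: a_small.
apply: damp_phase_retrievable gPR.
by apply: contraTneq a0 => /(congr1 (@normc R)); rewrite na normc0 => ->; rewrite ltxx.
Qed.
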